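(* (i) The polynomial sequence $\left\{\sum_{k=0}^n\mathrm{JS}(n,k;z)y^k\right\}_{n\geq0}$ is strongly $\{z,y\}$-log-convex. (ii) The polynomial sequence $\left\{\sum_{k=0}^n\mathrm{js}(n,k;z)y^k\right\}_{n\geq0}$ is strongly $\{z,y\}$-log-convex.
   Context: The Jacobi-Stirling numbers of the first kind $\mathrm{js}(n,k;z)$ and of the second kind $\mathrm{JS}(n,k;z)$ ($n\geq k\geq 0$) are defined by $\mathrm{js}(n,k;z)=\mathrm{js}(n-1,k-1;z)+(n-1)(n-1+z)\mathrm{js}(n-1,k;z)$ and $\mathrm{JS}(n,k;z)=\mathrm{JS}(n-1,k-1;z)+k(k+z)\mathrm{JS}(n-1,k;z)$, with $\mathrm{JS}(0,0;z)=\mathrm{js}(0,0;z)=1$ and $\mathrm{JS}(j,0;z)=\mathrm{JS}(0,j;z)=\mathrm{js}(j,0;z)=\mathrm{js}(0,j;z)=0$ for $j\geq1$. A sequence $\{f_n\}$ of polynomials in $\mathbb R_+[z,y]$ is strongly $\{z,y\}$-log-convex if $f_{k-1}f_{l+1}-f_kf_l\in\mathbb R_+[z,y]$ for all $l\geq k\geq1$. *)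

(* Defs.v *)
From mathcomp Require Export all_boot all_order all_algebra.
From mathcomp Require Export reals.

Set Implicit Arguments.
Unset Strict Implicit.
Unset Printing Implicit Defensive.

Import Order.TTheory GRing.Theory Num.Theory.

Local Open Scope ring_scope.

(* The recurrences force the value 0 whenever k > n; this covers the
   out-of-range terms JS(n - 1, n; z) and js(n - 1, n; z) that they mention. *)
Fixpoint JS2 (A : nzRingType) (n k : nat) (z : A) {struct n} : A :=
  match n, k with
  | 0, 0 => 1
  | 0, _.+1 => 0
  | _.+1, 0 => 0
  | n'.+1, k'.+1 =>
      JS2 n' k' z + k'.+1%:R * (k'.+1%:R + z) * JS2 n' k'.+1 z
  end.

Fixpoint js1 (A : nzRingType) (n k : nat) (z : A) {struct n} : A :=
  match n, k with
  | 0, 0 => 1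
  | 0, _.+1 => 0
  | _.+1, 0 => 0
  | n'.+1, k'.+1 =>
      js1 n' k' z + n'%:R * (n'%:R + z) * js1 n' k'.+1 z
  end.

(* R[z,y] is {poly {poly R}}: z is the inner variable, y the outer one. *)
Definition zvar (R : nzRingType) : {poly {poly R}} := 'X%:P.
Definition yvar (R : nzRingType) : {poly {poly R}} := 'X.

Definition JS2_poly (R : nzRingType) (n : nat) : {poly {poly R}} :=
  \sum_(k < n.+1) JS2 n k (zvar R) * yvar R ^+ k.

Definition js1_poly (R : nzRingType) (n : nat) : {poly {poly R}} :=
  \sum_(k < n.+1) js1 n k (zvar R) * yvar R ^+ k.

Definition nneg_poly2 (R : numDomainType) (p : {poly {poly R}}) : Prop :=
  forall i j : nat, 0 <= p`_i`_j.

Definition strongly_zy_log_convex (R : numDomainType)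
    (f : nat -> {poly {poly R}}) : Prop :=
  (forall n : nat, nneg_poly2 (f n)) /\
  (forall k l : nat, (1 <= k)%N -> (k <= l)%N ->
     nneg_poly2 (f k.-1 * f l.+1 - f k * f l)).

(* Main.v *)
Require Import Defs.
From mathcomp Require Import ring zify.

Set Implicit Arguments.
Unset Strict Implicit.
Unset Printing Implicit Defensive.

Import GRing.Theory.

Local Open Scope ring_scope.

(** Put [a_k = k (k + z)], so that [a_j - a_i = (j - i) (i + j + z)] is
    nonnegative for [i <= j]; of [a] only nonnegativity and this monotonicity
    are used.

    The first-kind polynomials satisfy [f_(n+1) = (y + a_n) f_n], hence
    [f_n f_(l+1) - f_(n+1) f_l = (a_l - a_n) f_n f_l].

    The second-kind polynomials satisfy [f_(n+1) = y f_n + L f_n] with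
    [L y^k = a_k y^k], hence
    [f_n f_(l+1) - f_(n+1) f_l = f_n (L f_l) - (L f_n) f_l].
    By the Binet-Cauchy identity this is the sum over [i < j] of
    [(JS(n,i) JS(l,j) - JS(n,j) JS(l,i)) (a_j - a_i) y^(i+j)], and the minors of
    the triangle are nonnegative because the same nonnegative bidiagonal matrix
    takes each row to the next. *)

Section BinetCauchy.

Variable A : comPzRingType.
Implicit Types p q u v : nat -> A.

Definition minor2 p q i j : A := p i * q j - p j * q i.

Lemma minor2_diag p q i : minor2 p q i i = 0.
Proof. exact: subrr. Qed.

Lemma Binet_Cauchy_identity p q u v n :
  (\sum_(i < n) p i * u i) * (\sum_(i < n) q i * v i)
    - (\sum_(i < n) p i * v i) * (\sum_(i < n) q i * u i)
  = \sum_(j < n) \sum_(i < j) minor2 p q i j * minor2 u v i j.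
Proof.
elim: n => [|n IHn]; first by rewrite !big_ord0 mulr0 subr0.
rewrite [RHS]big_ord_recr -IHn !big_ord_recr /=.
have -> : \sum_(i < n) minor2 p q i n * minor2 u v i n =
    (\sum_(i < n) p i * u i) * (q n * v n)
    - (\sum_(i < n) p i * v i) * (q n * u n)
    - (\sum_(i < n) q i * u i) * (p n * v n)
    + (\sum_(i < n) q i * v i) * (p n * u n).
  rewrite !mulr_suml -!sumrB -big_split.
  by apply: eq_bigr => i _; rewrite /minor2 /=; ring.
ring.
Qed.

End BinetCauchy.

Section BidiagonalTriangle.

Variable A : comPzRingType.
Implicit Types (a p : nat -> A) (w : nat -> nat -> A) (y : A).

Definition bidiag a p (k : nat) : A :=
  (if k is j.+1 then p j else 0) + a k * p k.

Fixpoint bidiag_triangle w (n : nat) : nat -> A :=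
  if n is m.+1 then bidiag (w m) (bidiag_triangle w m)
  else fun k => (k == 0)%:R.

Definition triangle_poly w y (n : nat) : A :=
  \sum_(k < n.+1) bidiag_triangle w n k * y ^+ k.

Lemma bidiag_triangle_gt w n k : (n < k)%N -> bidiag_triangle w n k = 0.
Proof.
elim: n k => [|n IHn] [|k] // lt_nk /=.
by rewrite /bidiag !IHn ?mulr0 ?addr0 // ltnW.
Qed.

Lemma triangle_poly_widen w y n N : (n < N)%N ->
  triangle_poly w y n = \sum_(k < N) bidiag_triangle w n k * y ^+ k.
Proof.
move=> lt_nN; rewrite -(subnKC lt_nN) big_split_ord /=.
rewrite [X in _ + X]big1 ?addr0 // => k _.
by rewrite bidiag_triangle_gt ?mul0r // leq_addr.
Qed.

Lemma triangle_polyS w y n N : (n < N)%N ->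
  triangle_poly w y n.+1 =
    y * triangle_poly w y n
    + \sum_(k < N) bidiag_triangle w n k * (w n k * y ^+ k).
Proof.
move=> lt_nN; rewrite (@triangle_poly_widen _ _ _ N.+1) //=.
under eq_bigr do rewrite /bidiag mulrDl.
rewrite big_split big_ord_recl big_ord_recr /= mul0r add0r.
rewrite bidiag_triangle_gt // mulr0 mul0r addr0.
rewrite (triangle_poly_widen _ _ lt_nN) mulr_sumr.
congr (_ + _); apply: eq_bigr => k _; last by rewrite mulrCA mulrA.
by rewrite /= exprS mulrCA.
Qed.

Lemma row_weight_triangle_polyS a y n :
  triangle_poly (fun m _ => a m) y n.+1 =
    (y + a n) * triangle_poly (fun m _ => a m) y n.
Proof.
rewrite (triangle_polyS _ _ (ltnSn n)) mulrDl; congr (_ + _).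
by rewrite mulr_sumr; apply: eq_bigr => k _; rewrite mulrCA.
Qed.

End BidiagonalTriangle.

Section Positivity.

Variables (A : comPzRingType) (P : semiringClosed A).
Implicit Types (p q b : nat -> A) (w : nat -> nat -> A) (y : A).

(* For positive sequences, [ratio_le p q] says that [q / p] is nondecreasing. *)
Definition ratio_le p q : Prop :=
  forall i j, (i <= j)%N -> minor2 p q i j \in P.

Lemma bidiag_ratio_le b p q : (forall k, b k \in P) ->
  ratio_le p q -> ratio_le (bidiag b p) (bidiag b q).
Proof.
move=> Pb le_pq i j; rewrite leq_eqVlt => /orP[/eqP-> | lt_ij].
  by rewrite minor2_diag rpred0.
case: j lt_ij => // j; case: i => [|i] lt_ij.
  have -> : minor2 (bidiag b p) (bidiag b q) 0 j.+1 =
      b 0 * minor2 p q 0 j + b 0 * b j.+1 * minor2 p q 0 j.+1.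
    by rewrite /minor2 /bidiag; ring.
  by rewrite !(le_pq, rpredD, rpredM).
have -> : minor2 (bidiag b p) (bidiag b q) i.+1 j.+1 =
    minor2 p q i j + b j.+1 * minor2 p q i j.+1
    + b i.+1 * minor2 p q i.+1 j + b i.+1 * b j.+1 * minor2 p q i.+1 j.+1.
  by rewrite /minor2 /bidiag; ring.
by rewrite !(le_pq, rpredD, rpredM) //; lia.
Qed.

Lemma rpred_bidiag_triangle w n k :
  (forall m j, w m j \in P) -> bidiag_triangle w n k \in P.
Proof.
move=> Pw; elim: n k => [|n IHn] k /=; first exact: rpred_nat.
by rewrite /bidiag rpredD ?rpredM //; case: k => [|k]; rewrite ?rpred0.
Qed.

Lemma rpred_triangle_poly w y n :
  (forall m j, w m j \in P) -> y \in P -> triangle_poly w y n \in P.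
Proof.
move=> Pw Py; apply: rpred_sum => k _.
by rewrite rpredM ?rpredX ?rpred_bidiag_triangle.
Qed.

Lemma bidiag_triangle_ratio_le b n l : (forall k, b k \in P) -> (n <= l)%N ->
  ratio_le (bidiag_triangle (fun=> b) n) (bidiag_triangle (fun=> b) l).
Proof.
move=> Pb; elim: n l => [|n IHn] l.
  move=> _ i [|j]; first by rewrite leqn0 => /eqP->; rewrite minor2_diag rpred0.
  by rewrite /minor2 mul0r subr0 rpredM ?rpred_nat ?rpred_bidiag_triangle.
by case: l => // l le_nl; apply: bidiag_ratio_le => //; apply: IHn.
Qed.

Definition strongly_log_convex (f : nat -> A) : Prop :=
  (forall n, f n \in P) /\
  (forall n l, (n <= l)%N -> f n * f l.+1 - f n.+1 * f l \in P).

Lemma eq_strongly_log_convex (f g : nat -> A) :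
  f =1 g -> strongly_log_convex f -> strongly_log_convex g.
Proof.
by move=> eq_fg [Pf cvx_f]; split=> [n|n l /cvx_f]; rewrite -!eq_fg.
Qed.

Variables (a : nat -> A) (y : A).
Hypotheses (Pa : forall k, a k \in P) (Py : y \in P).
Hypothesis a_mono : forall i j, (i <= j)%N -> a j - a i \in P.

Lemma column_weight_strongly_log_convex :
  strongly_log_convex (triangle_poly (fun=> a) y).
Proof.
split=> [n|n l le_nl]; first exact: rpred_triangle_poly.
set f := triangle_poly _ y; pose T := bidiag_triangle (fun=> a).
have fE m : (m <= l)%N -> f m = \sum_(k < l.+1) T m k * y ^+ k.
  by rewrite -ltnS; apply: triangle_poly_widen.
have fS m : (m <= l)%N ->
    f m.+1 = y * f m + \sum_(k < l.+1) T m k * (a k * y ^+ k).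
  by rewrite -ltnS; apply: triangle_polyS.
have -> : f n * f l.+1 - f n.+1 * f l =
    f n * (\sum_(k < l.+1) T l k * (a k * y ^+ k))
    - (\sum_(k < l.+1) T n k * (a k * y ^+ k)) * f l by rewrite !fS //; ring.
rewrite !fE //.
rewrite (Binet_Cauchy_identity (T n) (T l) (GRing.exp y)
  (fun k => a k * y ^+ k)).
apply: rpred_sum => j _; apply: rpred_sum => i _; apply: rpredM.
  exact/bidiag_triangle_ratio_le/ltnW.
have -> : minor2 (GRing.exp y) (fun k => a k * y ^+ k) i j =
    (a j - a i) * (y ^+ i * y ^+ j) by rewrite /minor2; ring.
by rewrite !rpredM ?rpredX // a_mono // ltnW.
Qed.

Lemma row_weight_strongly_log_convex :
  strongly_log_convex (triangle_poly (fun n _ => a n) y).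
Proof.
split=> [n|n l le_nl]; first exact: rpred_triangle_poly.
rewrite !row_weight_triangle_polyS; set f := triangle_poly _ y.
have -> : f n * ((y + a l) * f l) - (y + a n) * f n * f l =
    (a l - a n) * (f n * f l) by ring.
by rewrite !rpredM ?a_mono ?rpred_triangle_poly.
Qed.

End Positivity.

Section JacobiStirling.

Variables (A : comNzRingType) (z : A).

Definition jacobi_weight (k : nat) : A := k%:R * (k%:R + z).

Lemma JS2E n k : JS2 n k z = bidiag_triangle (fun=> jacobi_weight) n k.
Proof.
elim: n k => [|n IHn] [|k] //=; rewrite /bidiag -!IHn //.
by rewrite /jacobi_weight !mul0r addr0.
Qed.

Lemma js1E n k : js1 n k z = bidiag_triangle (fun m _ => jacobi_weight m) n k.
Proof.
elim: n k => [|n IHn] [|k] //=; rewrite /bidiag -!IHn //.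
by case: n {IHn} => [|n] /=; rewrite /jacobi_weight ?mul0r ?mulr0 addr0.
Qed.

Variable P : semiringClosed A.
Hypothesis Pz : z \in P.

Lemma rpred_jacobi_weight k : jacobi_weight k \in P.
Proof. by rewrite rpredM ?rpredD ?rpred_nat. Qed.

Lemma rpred_jacobi_weightB i j :
  (i <= j)%N -> jacobi_weight j - jacobi_weight i \in P.
Proof.
move=> le_ij.
have -> : jacobi_weight j - jacobi_weight i = (j - i)%:R * ((i + j)%:R + z).
  by rewrite /jacobi_weight natrB // natrD; ring.
by rewrite rpredM ?rpredD ?rpred_nat.
Qed.

End JacobiStirling.

Section NonnegativeCoefficients.

Variable R : numDomainType.

Definition nneg_coef2 : semiringClosed {poly {poly R}} :=
  GRing.SemiringClosed.clone _
    (polyOver_pred (polyOver_pred (@Num.Def.nneg_num_pred R))) _.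

Lemma nneg_coef2P (p : {poly {poly R}}) : p \in nneg_coef2 <-> nneg_poly2 p.
Proof.
split=> [/polyOverP Pp i j|Pp]; first exact: (polyOverP (Pp i)).
by apply/polyOverP=> i; apply/polyOverP=> j; apply: Pp.
Qed.

Lemma strongly_zy_log_convexW (f : nat -> {poly {poly R}}) :
  strongly_log_convex nneg_coef2 f -> strongly_zy_log_convex f.
Proof.
case=> Pf cvx_f; split=> [n|[|k] l // _ /ltnW le_kl]; apply/nneg_coef2P => //.
exact: cvx_f.
Qed.

Lemma zvar_nneg_coef2 : zvar R \in nneg_coef2.
Proof. by rewrite polyOverC polyOverX. Qed.

Lemma yvar_nneg_coef2 : yvar R \in nneg_coef2.
Proof. exact: polyOverX. Qed.

End NonnegativeCoefficients.

Theorem theorem1p4 (R : realType) :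
  strongly_zy_log_convex (@JS2_poly R) /\
  strongly_zy_log_convex (@js1_poly R).
Proof.
have weight_nneg := rpred_jacobi_weight (zvar_nneg_coef2 R).
have weight_mono := rpred_jacobi_weightB (zvar_nneg_coef2 R).
split; apply: strongly_zy_log_convexW.
- apply: eq_strongly_log_convex (column_weight_strongly_log_convex
    weight_nneg (yvar_nneg_coef2 R) weight_mono) => n.
  by apply: eq_bigr => k _; rewrite JS2E.
- apply: eq_strongly_log_convex (row_weight_strongly_log_convex
    weight_nneg (yvar_nneg_coef2 R) weight_mono) => n.
  by apply: eq_bigr => k _; rewrite js1E.
Qed.
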